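(* Let $\epsilon_1,\epsilon_2$ be nonzero complex numbers with $\epsilon_1\neq\epsilon_2$, and for every integer $x$ put $[x]:=\dfrac{\epsilon_1^x-\epsilon_2^x}{\epsilon_1-\epsilon_2}$. For $n\in\mathbb{Z}$ let $l_n$ be the operator acting on holomorphic functions $\varphi$ on $\mathbb{C}\setminus\{0\}$ by $$l_n\varphi(z):=\epsilon_1^{-z\partial_z}\,[z\partial_z-n]\,z^n\varphi(z).$$ Then for all $n,m\in\mathbb{Z}$ the following two identities of operators hold: $$\epsilon_1^{m-n}\,l_n l_m-\epsilon_2^{m-n}\,l_m l_n=[m-n]\,l_{n+m},$$ $$l_n l_m-l_m l_n=[m-n]\,\epsilon_1^{-z\partial_z+n}\,\epsilon_2^{z\partial_z-m}\,l_{n+m}.$$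
   Context: For a nonzero complex number $\epsilon$ and an integer $a$, the operators $\epsilon^{z\partial_z+a}$ and $\epsilon^{-z\partial_z+a}$ act on functions by $\epsilon^{z\partial_z+a}\varphi(z)=\epsilon^{a}\varphi(\epsilon z)$ and $\epsilon^{-z\partial_z+a}\varphi(z)=\epsilon^{a}\varphi(\epsilon^{-1}z)$; thus on monomials $z^k$ they are multiplication by $\epsilon^{k+a}$ and $\epsilon^{-k+a}$, respectively. The operator $[z\partial_z-n]$ is $\dfrac{\epsilon_1^{z\partial_z-n}-\epsilon_2^{z\partial_z-n}}{\epsilon_1-\epsilon_2}$, so that $[z\partial_z-n]z^k=[k-n]z^k$. The symbol $z^n$ denotes the operator of multiplication by $z^n$. Products of operators are compositions, the rightmost operator being applied first; for instance, $l_n$ first multiplies by $z^n$, then applies $[z\partial_z-n]$, then applies $\epsilon_1^{-z\partial_z}$. *)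

(* Defs.v *)
From HB Require Import structures.
From mathcomp Require Import all_boot all_order all_algebra.
From mathcomp Require Import complex.
From mathcomp Require Import all_classical all_reals all_analysis.

Set Implicit Arguments.
Unset Strict Implicit.
Unset Printing Implicit Defensive.

Import Order.TTheory GRing.Theory Num.Theory.
Import numFieldNormedType.Exports.

Local Open Scope ring_scope.

(* The definitions are given over a [numFieldType] [C]; the intended instance
   is [C := R[i]] for a [realType] [R]. *)

Definition cstar (C : numFieldType) : Type := {z : C | z != 0}.

Definition cstar_mul (C : numFieldType) (c z : cstar C) : cstar C :=
  exist _ (sval c * sval z) (mulf_neq0 (valP c) (valP z)).

Fact cstar_inv_subproof (C : numFieldType) (c : cstar C) : (sval c)^-1 != 0.
Proof. by rewrite invr_eq0 (valP c). Qed.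

Definition cstar_inv (C : numFieldType) (c : cstar C) : cstar C :=
  exist _ (sval c)^-1 (cstar_inv_subproof c).

(* [derivable] needs a function on the whole normed space.  The value chosen
   at 0 is irrelevant, since derivability is only required at nonzero points,
   and these form an open set. *)
Definition extend0 (C : numFieldType) (f : cstar C -> C) (z : C) : C :=
  if insub z is Some u then f u else 0.

(* The increment in [derivable] ranges over the base field of the normed
   space, here [C] itself: for [C := R[i]] this is complex differentiability
   at every point of the punctured plane. *)
Definition holomorphic (C : numFieldType) : {pred cstar C -> C} :=
  fun f => `[< forall z : cstar C, derivable (extend0 f) (sval z) 1 >].

Record holo (C : numFieldType) := Holo {
  holo_fun :> cstar C -> C;
  holo_funP : holo_fun \in @holomorphic C }.
Arguments Holo {C}.

HB.instance Definition _ (C : numFieldType) := [isSub for @holo_fun C].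
HB.instance Definition _ (C : numFieldType) := [Choice of holo C by <:].

Section HoloLmodule.
Variable C : numFieldType.
Implicit Types f g : cstar C -> C.

Lemma extend0_val f (z : cstar C) : extend0 f (sval z) = f z.
Proof. by rewrite /extend0 -[sval z]/(val z) valK. Qed.

Lemma extend0_0 f : extend0 f 0 = 0.
Proof. by rewrite /extend0 insubF ?eqxx. Qed.

Lemma extend0E f g (h : C -> C -> C) (s : C -> C) :
  (forall z, h z 0 = 0) -> s 0 = 0 ->
  (forall z : cstar C, g z = h (sval z) (extend0 f (s (sval z)))) ->
  extend0 g = fun z => h z (extend0 f (s z)).
Proof.
move=> h0 s0 hfg; apply/funext => z; have [->|z0] := eqVneq z 0.
  by rewrite s0 !extend0_0 h0.
by rewrite -[z]/(sval (exist (fun z => z != 0) z z0 : cstar C)) extend0_val hfg.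
Qed.

Lemma holomorphic_submod : submod_closed (@holomorphic C).
Proof.
split.
  apply/asboolP => z.
  rewrite (_ : extend0 _ = cst 0); first exact: derivable_cst.
  by apply/funext => w; rewrite /extend0; case: insub.
move=> a f g /asboolP hf /asboolP hg; apply/asboolP => z.
rewrite (_ : extend0 _ = (a \*: extend0 f) + extend0 g).
  by apply: derivableD (hg z); apply: derivableZ (hf z).
apply/funext => w; rewrite /extend0 /GRing.add /=.
by case: insub => [u//|]; rewrite scaler0 addr0.
Qed.

HB.instance Definition _ :=
  GRing.isSubmodClosed.Build _ _ (@holomorphic C) holomorphic_submod.
HB.instance Definition _ := [SubChoice_isSubLmodule of holo C by <:].

End HoloLmodule.

Section Operators.
Variable C : numFieldType.

Lemma derivable_dilate (f : C -> C) (c z : C) :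
  derivable f (c * z) 1 -> derivable (fun w => f (c * w)) z 1.
Proof.
move=> /derivable1_diffP df; apply/derivable1_diffP.
exact: (@differentiable_comp _ _ _ _ ( *%R c) f).
Qed.

Lemma derivable_exprz (n : int) (z : cstar C) :
  derivable (fun w : C => w ^ n) (sval z) 1.
Proof.
case: n => n; first exact: exprn_derivable.
apply: (@derivableV C C (fun w => w ^+ n.+1)); last exact: exprn_derivable.
by rewrite expf_neq0 // (valP z).
Qed.

Lemma dilate_holomorphic (c : cstar C) (phi : holo C) :
  (fun z => phi (cstar_mul c z)) \in @holomorphic C.
Proof.
have /asboolP hphi := holo_funP phi; apply/asboolP => z.
rewrite (extend0E (f := phi) (h := fun _ w => w) (s := *%R (sval c))) //=.
- exact/derivable_dilate/(hphi (cstar_mul c z)).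
- by rewrite mulr0.
- by move=> w; rewrite -[sval c * sval w]/(sval (cstar_mul c w)) extend0_val.
Qed.

Definition dilate (c : cstar C) (phi : holo C) : holo C :=
  Holo (fun z => phi (cstar_mul c z)) (dilate_holomorphic c phi).

Lemma mulz_holomorphic (n : int) (phi : holo C) :
  (fun z : cstar C => sval z ^ n * phi z) \in @holomorphic C.
Proof.
have /asboolP hphi := holo_funP phi; apply/asboolP => z.
rewrite (extend0E (f := phi) (h := fun z w => z ^ n * w) (s := id)) //=.
- exact: derivableM (@derivable_exprz n z) (hphi z).
- by move=> w; rewrite mulr0.
- by move=> w; rewrite extend0_val.
Qed.

Definition mulz (n : int) (phi : holo C) : holo C :=
  Holo (fun z => sval z ^ n * phi z) (mulz_holomorphic n phi).

(* eps ^ (z d/dz + a) *)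
Definition eps_zd (eps : cstar C) (a : int) (phi : holo C) : holo C :=
  sval eps ^ a *: dilate eps phi.

(* eps ^ (- z d/dz + a) *)
Definition eps_Nzd (eps : cstar C) (a : int) (phi : holo C) : holo C :=
  sval eps ^ a *: dilate (cstar_inv eps) phi.

Variables eps1 eps2 : cstar C.

(* [x] *)
Definition qint (x : int) : C :=
  (sval eps1 ^ x - sval eps2 ^ x) / (sval eps1 - sval eps2).

(* [z d/dz - n] *)
Definition qzd (n : int) : holo C -> holo C :=
  (sval eps1 - sval eps2)^-1 *: (eps_zd eps1 (- n) - eps_zd eps2 (- n)).

Definition l_op (n : int) : holo C -> holo C :=
  eps_Nzd eps1 0 \o qzd n \o mulz n.

End Operators.

(* Main.v *)
(* Pointwise, with q = eps2 / eps1 and d = eps1 - eps2,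
     (l_n phi)(z) = d^-1 (z / eps1)^n (phi(z) - phi(q z)),
   so that (l_n l_m phi)(z) is d^-2 (z / eps1)^(n+m) times
     (phi(z) - phi(q z)) - q^m (phi(q z) - phi(q^2 z)).
   The bracket is symmetric in n and m except for the factor q^m; the weights
   eps1^(m-n), eps2^(m-n) cancel the q^2 terms, since
   eps1^(m-n) q^m = eps2^(m-n) q^n, while in the plain commutator only
   (q^n - q^m) (phi(q z) - phi(q^2 z)) survives. *)
Require Import Defs.
From mathcomp Require Import all_boot all_order all_algebra.
From mathcomp Require Import complex.
From mathcomp Require Import all_classical all_reals all_analysis.
From mathcomp Require Import ring.
Import GRing.Theory.
Local Open Scope ring_scope.
Local Open Scope complex_scope.

Section WittOperators.
Variable C : numFieldType.
Implicit Types (c z eps : cstar C) (phi psi : holo C) (n m : int).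

Lemma holo_ext phi psi : (forall z, phi z = psi z) -> phi = psi.
Proof. by move=> eq_phi; apply: val_inj; apply/funext. Qed.

Lemma holo_addE phi psi z : (phi + psi) z = phi z + psi z.
Proof. by []. Qed.

Lemma holo_oppE phi z : (- phi) z = - phi z.
Proof. by []. Qed.

Lemma holo_scaleE (a : C) phi z : (a *: phi) z = a * phi z.
Proof. by []. Qed.

Lemma cstar_mulA c1 c2 z :
  cstar_mul c1 (cstar_mul c2 z) = cstar_mul (cstar_mul c1 c2) z.
Proof. by apply: val_inj => /=; rewrite mulrA. Qed.

Lemma cstar_mulVK c z : cstar_mul c (cstar_mul (cstar_inv c) z) = z.
Proof. by apply: val_inj => /=; rewrite mulVKf // (valP c). Qed.

Lemma eps_NzdE eps n phi z :
  eps_Nzd eps n phi z = sval eps ^ n * phi (cstar_mul (cstar_inv eps) z).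
Proof. by []. Qed.

Lemma eps_zdE eps n phi z :
  eps_zd eps n phi z = sval eps ^ n * phi (cstar_mul eps z).
Proof. by []. Qed.

Variables eps1 eps2 : cstar C.
Let q := cstar_mul eps2 (cstar_inv eps1).

(** The final dilation by [eps1^-1] turns the two dilations of [qzd] into the identity and [q]. In
    each, the weight [eps^(-n)] cancels the [eps^n] coming from multiplication by [z^n], so both
    share the factor [(z / eps1)^n]. *)
Lemma l_opE n phi z :
  l_op eps1 eps2 n phi z =
  (sval eps1 - sval eps2)^-1 * (sval z / sval eps1) ^ n
    * (phi z - phi (cstar_mul q z)).
Proof.
have e1 := valP eps1; have e2 := valP eps2.
rewrite eps_NzdE expr0z mul1r !(holo_addE, holo_oppE, holo_scaleE) /=.
rewrite cstar_mulVK cstar_mulA -/q.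
rewrite !expfzMl -!invr_expz exprz_inv -invr_expz.
have := expfz_neq0 n e1; have := expfz_neq0 n e2.
move: (_ ^ n) => b; move: (_ ^ n) => a b0 a0.
rewrite -mulrA; congr (_ * _); field.
by rewrite a0 b0.
Qed.

Lemma l_op_comp n m phi z :
  l_op eps1 eps2 n (l_op eps1 eps2 m phi) z =
  (sval eps1 - sval eps2)^-1 ^+ 2 * (sval z / sval eps1) ^ (n + m)
    * (phi z - phi (cstar_mul q z)
       - (sval eps2 / sval eps1) ^ m
         * (phi (cstar_mul q z) - phi (cstar_mul q (cstar_mul q z)))).
Proof.
have u0 : sval z / sval eps1 != 0.
  by rewrite mulf_neq0 ?invr_eq0 ?(valP z) ?(valP eps1).
(* The factor [q^m] comes from evaluating [(z / eps1)^m] at [q z]. *)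
rewrite !l_opE expfzDr //= -[_ * sval z / _]mulrA (expfzMl _ (sval z / _)).
ring.
Qed.

(** The surviving difference [phi(z) - phi(q z)] carries [eps1^(m-n) - eps2^(m-n)], which is [[m-n]]
    up to one factor [eps1 - eps2]. *)
Lemma l_op_qcommutator n m :
  sval eps1 ^ (m - n) *: (l_op eps1 eps2 n \o l_op eps1 eps2 m)
    - sval eps2 ^ (m - n) *: (l_op eps1 eps2 m \o l_op eps1 eps2 n)
  = qint eps1 eps2 (m - n) *: l_op eps1 eps2 (n + m).
Proof.
apply/funext => phi; apply: holo_ext => z.
rewrite !fctE holo_addE holo_oppE [RHS]holo_scaleE.
rewrite [X in X - _ = _]holo_scaleE [X in _ - X = _]holo_scaleE.
rewrite (l_op_comp n m) (l_op_comp m n) l_opE (addrC m n) /qint.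
move: ((_ / sval eps1) ^ (n + m)) => w.
have e1 := valP eps1; have e2 := valP eps2.
rewrite !(expfzDr _ _ e1) !(expfzDr _ _ e2) !expfzMl !exprz_inv -!invr_expz.
have := expfz_neq0 n e1; have := expfz_neq0 n e2.
have := expfz_neq0 m e1.
(* With the powers taken as independent atoms, a rational identity remains. *)
move: (sval eps1 ^ n) (sval eps2 ^ n) (sval eps1 ^ m) (sval eps2 ^ m).
move: ((_ - _)^-1) => d a b a' b' a'0 b0 a0.
field.
by rewrite a0 b0 a'0.
Qed.

(** The two dilations on the right move the evaluation point to [q z], giving
    [phi(q z) - phi(q^2 z)]. The coefficients agree since [eps1^n eps2^(-m) q^(n+m) (eps1^(m-n) -
    eps2^(m-n)) = q^n - q^m]. *)
Lemma l_op_commutator n m :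
  (l_op eps1 eps2 n \o l_op eps1 eps2 m)
    - (l_op eps1 eps2 m \o l_op eps1 eps2 n)
  = qint eps1 eps2 (m - n) *:
      (eps_Nzd eps1 n \o eps_zd eps2 (- m) \o l_op eps1 eps2 (n + m)).
Proof.
apply/funext => phi; apply: holo_ext => z.
rewrite !fctE holo_addE holo_oppE [RHS]holo_scaleE eps_NzdE eps_zdE.
rewrite cstar_mulA -/q (l_op_comp n m) (l_op_comp m n) l_opE (addrC m n) /qint /=.
have e1 := valP eps1; have e2 := valP eps2.
rewrite -[_ * sval z / _]mulrA (expfzMl _ (sval z / _)).
move: ((sval z / _) ^ (n + m)) => w.
rewrite (expfzDr _ _ (mulf_neq0 e2 (invr_neq0 e1))).
rewrite !(expfzDr _ _ e1) !(expfzDr _ _ e2) !(expfzMl (sval eps2)).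
rewrite !exprz_inv -!invr_expz.
have := expfz_neq0 n e1; have := expfz_neq0 n e2.
have := expfz_neq0 m e1; have := expfz_neq0 m e2.
move: (sval eps1 ^ n) (sval eps2 ^ n) (sval eps1 ^ m) (sval eps2 ^ m).
move: ((_ - _)^-1) => d a b a' b' b'0 a'0 b0 a0.
field.
by rewrite a0 b0 a'0 b'0.
Qed.

End WittOperators.

Theorem theorem2p1 (R : realType) (eps1 eps2 : cstar R[i])
    (neq_eps : sval eps1 <> sval eps2) (n m : int) :
  sval eps1 ^ (m - n) *: (l_op eps1 eps2 n \o l_op eps1 eps2 m)
    - sval eps2 ^ (m - n) *: (l_op eps1 eps2 m \o l_op eps1 eps2 n)
  = qint eps1 eps2 (m - n) *: l_op eps1 eps2 (n + m)
  /\
  (l_op eps1 eps2 n \o l_op eps1 eps2 m) - (l_op eps1 eps2 m \o l_op eps1 eps2 n)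
  = qint eps1 eps2 (m - n) *:
      (eps_Nzd eps1 n \o eps_zd eps2 (- m) \o l_op eps1 eps2 (n + m)).
Proof. by split; [exact: l_op_qcommutator | exact: l_op_commutator]. Qed.
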